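(* Let $X$ be a real or complex Banach space whose dual $X^*$ is separable. Let $f\in L^{1}([0,1],X)$ be such that $\|f\|=1$ and $f(t)\neq 0$ almost everywhere. Then $S_f$ is norm compact if and only if $f$ is smooth in $L^1([0,1],X)$.
   Context: $[0,1]$ carries Lebesgue measure $\mu$ on the Lebesgue $\sigma$-field, and $L^1([0,1],X)$ is the Banach space of (equivalence classes of) $X$-valued Bochner integrable functions with norm $\|f\|=\int_{[0,1]}\|f(t)\|\,d\mu(t)$. ''$f(t)\neq 0$ almost everywhere'' means $\mu(\{t\in[0,1]:\|f(t)\|=0\})=0$. For a Banach space $E$, $S(E)$ denotes its unit sphere, and for $e\in S(E)$ the state space of $e$ is $S_e=\{e^*\in S(E^* ):e^*(e)=1\}$; here it is taken with $E=L^1([0,1],X)$, so $S_f\subseteq L^1([0,1],X)^*$. A point $e\in S(E)$ is smooth in $E$ if $S_e$ is a singleton. Norm compact means compact in the norm topology of the dual space. *)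

(* Defs.v *)
From HB Require Import structures.
From mathcomp Require Import all_boot all_order all_algebra.
From mathcomp Require Import all_classical all_reals all_analysis measurable_realfun.
From mathcomp.real_closed Require Import complex.

Set Implicit Arguments.
Unset Strict Implicit.
Unset Printing Implicit Defensive.

Import Order.TTheory GRing.Theory Num.Theory.
Import numFieldNormedType.Exports.

Local Open Scope classical_set_scope.
Local Open Scope ring_scope.

(** Norms in this library take values in the scalar field, so over [R[i]] they
    are nonnegative elements of [R[i]]. The maps [reS] and [ofR] (identities in
    the real case) pass between these and [R], where integrals and suprema are
    formed. *)
Variant scalar_kind := RealScalars | ComplexScalars.

Definition scalars (R : realType) (k : scalar_kind) : numFieldType :=
  match k with
  | RealScalars => R : numFieldType
  | ComplexScalars => R[i] : numFieldType
  end.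

Definition reS (R : realType) (k : scalar_kind) : scalars R k -> R :=
  match k return scalars R k -> R with
  | RealScalars => id
  | ComplexScalars => @complex.Re R
  end.

Definition ofR (R : realType) (k : scalar_kind) : R -> scalars R k :=
  match k return R -> scalars R k with
  | RealScalars => id
  | ComplexScalars => real_complex R
  end.
Arguments ofR {R k} _.

Section scalars_theory.
Context {R : realType} {k : scalar_kind}.
Local Notation K := (scalars R k).

Lemma ofRK : cancel (@ofR R k) (@reS R k).
Proof. by case: k. Qed.

Lemma reSK (x : K) : 0 <= x -> ofR (reS x) = x.
Proof.
case: k x => [x _ //|[a b]].
by rewrite lecE => /andP[/eqP /= -> _].
Qed.

Lemma ler_ofR (x y : R) : ((ofR x : K) <= ofR y) = (x <= y).
Proof. by case: k => //=; rewrite lecR. Qed.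

Lemma ofRD (x y : R) : (ofR (x + y) : K) = ofR x + ofR y.
Proof. by case: k => //=; rewrite rmorphD. Qed.

Lemma ofRM (x y : R) : (ofR (x * y) : K) = ofR x * ofR y.
Proof. by case: k => //=; rewrite rmorphM. Qed.

Lemma ofR0 : (ofR 0 : K) = 0.
Proof. by case: k. Qed.

Lemma reS_ge0 (x : K) : 0 <= x -> 0 <= reS x.
Proof. by move=> x0; rewrite -ler_ofR reSK// ofR0. Qed.

Lemma ler_reS (x y : K) : 0 <= x -> x <= y -> reS x <= reS y.
Proof.
by move=> x0 xy; rewrite -ler_ofR !reSK// (le_trans x0 xy).
Qed.

End scalars_theory.

Section rnorm.
Context {R : realType} {k : scalar_kind} {E : normedModType (scalars R k)}.
Local Notation K := (scalars R k).
Implicit Types x y : E.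

Definition rnorm x : R := reS `|x|.

Lemma rnormE x : (ofR (rnorm x) : K) = `|x|.
Proof. exact: reSK. Qed.

Lemma rnorm_ge0 x : 0 <= rnorm x.
Proof. exact: reS_ge0. Qed.

Lemma rnormD x y : rnorm (x + y) <= rnorm x + rnorm y.
Proof. by rewrite -(@ler_ofR _ k) ofRD !rnormE ler_normD. Qed.

Lemma rnormN x : rnorm (- x) = rnorm x.
Proof. by rewrite /rnorm normrN. Qed.

Lemma rnorm0 : rnorm (0 : E) = 0.
Proof. by rewrite /rnorm normr0 -ofR0 ofRK. Qed.

Lemma rnorm0_eq0 x : rnorm x = 0 -> x = 0.
Proof. by move=> x0; apply/eqP; rewrite -normr_eq0 -rnormE x0 ofR0. Qed.

Lemma rnormZ (a : K) x : rnorm (a *: x) = reS `|a| * rnorm x.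
Proof.
by rewrite -[LHS](@ofRK _ k) rnormE normrZ -[`|a|]reSK// -rnormE -ofRM !ofRK.
Qed.

Lemma ler_rnormB x y : `|rnorm x - rnorm y| <= rnorm (x - y).
Proof.
have h u v : rnorm u - rnorm v <= rnorm (u - v).
  by rewrite lerBlDr (le_trans _ (rnormD _ _))// subrK.
by rewrite ler_norml h andbT lerNl opprB -(rnormN (x - y)) opprB h.
Qed.

Lemma rnorm_continuous : continuous rnorm.
Proof.
move=> x; apply/cvgrPdist_le => e e0.
have : (0 : K) < ofR e by rewrite lt_neqAle -{2}ofR0 ler_ofR ltW// andbT -ofR0
  (can_eq ofRK) lt_eqF.
move=> e0'; have /cvgrPdist_le/(_ _ e0') := (@cvg_id _ (nbhs x)).
apply: filterS => y; rewrite -rnormE ler_ofR; apply: le_trans.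
exact: ler_rnormB.
Qed.

End rnorm.

Section dual.
Context {R : realType} {k : scalar_kind} (E : normedModType (scalars R k)).
Local Notation K := (scalars R k).

Definition continuous_linear : {pred E -> K^o} :=
  mem [set phi : E -> K^o | linear phi /\ continuous phi].

Lemma continuous_linear_submod_closed : submod_closed continuous_linear.
Proof.
split.
  apply/mem_set; split; last exact: cst_continuous.
  by move=> a x y; rewrite /GRing.zero/= scaler0 addr0.
move=> a f g /set_mem[lf cf] /set_mem[lg cg]; apply/mem_set; split.
  move=> b x y; rewrite /GRing.add/= /GRing.scale/= lf lg.
  rewrite /GRing.scale/= !mulrDr; rewrite [a * (b * _)]mulrCA.
  by rewrite addrACA.
move=> x; apply: (@continuousD _ _ _ (fun y => a *: f y) g x); last exact: cg.
by apply: cvgZl_tmp; exact: cf.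
Qed.

HB.instance Definition _ := GRing.isSubmodClosed.Build _ _ continuous_linear
  continuous_linear_submod_closed.

(** The dual of [E], with the operator norm (see [dual_normE]). *)
Record dual := Dual {
  dual_fun :> E -> K^o ;
  dual_funP : dual_fun \in continuous_linear }.

HB.instance Definition _ := [isSub for dual_fun].
HB.instance Definition _ := [Choice of dual by <:].
HB.instance Definition _ := [SubChoice_isSubLmodule of dual by <:].

Definition dual_norm (phi : dual) : R :=
  sup [set rnorm (phi x) | x in [set x | `|x| <= 1]].

Lemma dual_has_sup phi : has_sup [set rnorm (dual_fun phi x) | x in [set x | `|x| <= 1]].
Proof.
have [lf cf] := set_mem (dual_funP phi).
split; first by exists (rnorm (phi 0)); exists 0 => //=; rewrite normr0.
pose f : {linear E -> K^o} := HB.pack (phi : E -> K^o) (GRing.isLinear.Build _ _ _ _ _ lf).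
have := (@linear_bounded_continuous _ _ _ f).2 cf.
move=> /linear_boundedP /pinfty_ex_gt0 [M M0 fM].
exists (reS M) => _ [x /= x1 <-].
apply: ler_reS => //.
apply: (le_trans (fM x)).
by rewrite -[leRHS]mulr1 ler_wpM2l// ltW.
Qed.

Lemma dual_normP phi x : rnorm (dual_fun phi x) <= dual_norm phi * rnorm x.
Proof.
have [lf cf] := set_mem (dual_funP phi).
pose f : {linear E -> K^o} := HB.pack (phi : E -> K^o) (GRing.isLinear.Build _ _ _ _ _ lf).
have [->|x0] := eqVneq x 0.
  by rewrite (_ : phi 0 = 0) ?rnorm0 ?mulr0//; exact: (linear0 f).
have nx0 : 0 < rnorm x.
  rewrite lt_neqAle rnorm_ge0 andbT eq_sym; apply: contra_neq x0.
  exact: rnorm0_eq0.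
rewrite -ler_pdivrMr//.
apply: ub_le_sup; first by have [] := dual_has_sup phi.
exists (`|x|^-1 *: x) => /=.
  by rewrite normrZ normfV normr_id mulVf// normr_eq0.
rewrite (_ : phi _ = `|x|^-1 *: phi x); last exact: (linearZ_LR f).
rewrite rnormZ mulrC; congr (_ * _).
rewrite normfV normr_id -rnormE.
apply: (mulfI (lt0r_neq0 nx0)); rewrite mulfV ?gt_eqF//.
apply: (can_inj (@ofRK R k)); rewrite ofRM reSK; last first.
  by rewrite invr_ge0 rnormE.
by rewrite mulfV ?rnormE ?normr_eq0//; case: (k).
Qed.

Lemma dual_norm_le phi (r : R) :
  (forall x, `|x| <= 1 -> rnorm (dual_fun phi x) <= r) -> dual_norm phi <= r.
Proof.
move=> h; apply: ge_sup; first by have [] := dual_has_sup phi.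
by move=> _ [x /= x1 <-]; exact: h.
Qed.

Lemma dual_norm_ub phi x : `|x| <= 1 -> rnorm (dual_fun phi x) <= dual_norm phi.
Proof.
move=> x1; apply: ub_le_sup; first by have [] := dual_has_sup phi.
by exists x.
Qed.

Lemma dual_norm_ge0 phi : 0 <= dual_norm phi.
Proof.
by apply: le_trans (dual_norm_ub phi (_ : `|0 : E| <= 1));
  rewrite ?rnorm_ge0// normr0.
Qed.

Let nm phi : K := ofR (dual_norm phi).

Let nmD (phi psi : dual) : nm (phi + psi) <= nm phi + nm psi.
Proof.
rewrite -ofRD ler_ofR; apply: dual_norm_le => x x1.
by apply: (le_trans (rnormD _ _)); rewrite lerD// dual_norm_ub.
Qed.

Let nmZ (a : K) (phi : dual) : nm (a *: phi) = `|a| * nm phi.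
Proof.
have le b psi : dual_norm (b *: psi) <= reS `|b| * dual_norm psi.
  apply: dual_norm_le => x x1; rewrite [X in rnorm X](_ : _ = b *: psi x)//.
  by rewrite rnormZ ler_wpM2l ?reS_ge0// dual_norm_ub.
rewrite -[`|a|]reSK// -ofRM; congr ofR; apply/eqP; rewrite eq_le le /=.
have [->|a0] := eqVneq a 0.
  by rewrite normr0 -ofR0 ofRK mul0r dual_norm_ge0.
have ra0 : 0 < reS `|a|.
  rewrite lt_neqAle reS_ge0// andbT; apply: contra_neq a0 => h.
  by apply/eqP; rewrite -normr_eq0 -[`|a|]reSK// -h ofR0.
rewrite -ler_pdivlMl// -{1}[phi](scalerK a0).
apply: (le_trans (le _ _)); rewrite ler_wpM2r ?dual_norm_ge0//.
rewrite le_eqVlt; apply/orP; left; apply/eqP.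
apply: (mulfI (lt0r_neq0 ra0)); rewrite mulfV ?gt_eqF//.
apply: (can_inj (@ofRK R k)); rewrite ofRM !reSK// -normrM mulfV// normr1.
by case: (k).
Qed.

Let nm0 (phi : dual) : nm phi = 0 -> phi = 0.
Proof.
move=> /(congr1 (@reS _ k)); rewrite ofRK -ofR0 ofRK => phi0.
apply/val_inj/funext => x; apply/rnorm0_eq0/eqP; rewrite eq_le rnorm_ge0 andbT.
by apply: (le_trans (dual_normP _ _)); rewrite phi0 mul0r.
Qed.

HB.instance Definition _ := @Lmodule_isNormed.Build K dual nm nmD nmZ nm0.

Lemma dual_normE (phi : dual) :
  `|phi| = ofR (sup [set rnorm (phi x) | x in [set x | `|x| <= 1]]).
Proof. by []. Qed.

End dual.

Section state_space.
Context {R : realType} {k : scalar_kind} {E : normedModType (scalars R k)}.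

Definition state_space (e : E) : set (dual E) :=
  [set phi : dual E | `|phi| = 1 /\ phi e = 1].

Definition smooth_point (e : E) :=
  `|e| = 1 /\ exists phi, state_space e = [set phi].

End state_space.

Definition separable (T : topologicalType) :=
  exists2 A : set T, countable A & dense A.

Section bochner.
Context {R : realType} {k : scalar_kind} {X : normedModType (scalars R k)}.
Context {d} {T : measurableType d} (mu : {measure set T -> \bar R}) (D : set T).
Implicit Types f g s : T -> X.

(** The general definitions are meant for [mu D < +oo], where every simple
    function is integrable on [D]. *)
Definition simple_fun s :=
  finite_set (range s) /\ forall x, measurable (s @^-1` [set x]).

Definition strongly_measurable f :=
  exists s_ : (T -> X)^nat, (forall n, simple_fun (s_ n)) /\
    {ae mu, forall t, D t -> s_ n t @[n --> \oo] --> f t}.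

(** The integral makes sense: strong measurability of [f] and a complete [mu]
    make [t |-> |f t - s_ n t|] measurable on [D] (see [measurable_rnorm]). *)
Definition bochner_integrable f :=
  strongly_measurable f /\
  exists s_ : (T -> X)^nat, (forall n, simple_fun (s_ n)) /\
    (\int[mu]_(t in D) (rnorm (f t - s_ n t))%:E @[n --> \oo] --> 0)%E.

Definition L1norm f : R := fine (\int[mu]_(t in D) (rnorm (f t))%:E).

Lemma simple_preimage (Y : Type) (h : X -> Y) s (B : set Y) : simple_fun s ->
  measurable ((h \o s) @^-1` B).
Proof.
move=> [fs ms].
rewrite (_ : _ @^-1` _ = \bigcup_(x in range s `&` h @^-1` B) s @^-1` [set x]).
  by apply: fin_bigcup_measurable => //; exact: finite_setIl.
apply/seteqP; split => [t /= Bt|t [x [_ /= Bx] /= tx]]; last by rewrite /= tx.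
by exists (s t) => //; split => //; exists t.
Qed.

Lemma simple2 (h : X -> X -> X) s t : simple_fun s -> simple_fun t ->
  simple_fun (fun x => h (s x) (t x)).
Proof.
move=> ss st; split.
  apply: (@sub_finite_set _ _ ((fun p => h p.1 p.2) @` (range s `*` range t))).
    by move=> _ [x _ <-]; exists (s x, t x) => //; split; exists x.
  by apply: finite_image; apply: finite_setX; [exact: ss.1|exact: st.1].
move=> x.
rewrite (_ : _ @^-1` _ = \bigcup_(a in range s)
  (s @^-1` [set a] `&` (h a \o t) @^-1` [set x])).
  apply: fin_bigcup_measurable; first exact: ss.1.
  move=> a _; apply: measurableI; first exact: ss.2.
  exact: simple_preimage.
apply/seteqP; split => [y /= hy|y [a _ [/= sy ty]]]; last by rewrite /= sy.
by exists (s y); [exists y|split].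
Qed.

Lemma simple0 : simple_fun (cst 0 : T -> X).
Proof.
split.
  by apply: (@sub_finite_set _ _ [set 0]) => [y [t _ <-]|].
move=> x; have [->|x0] := eqVneq x 0.
  by rewrite (_ : _ @^-1` _ = setT)//; apply/seteqP; split.
rewrite (_ : _ @^-1` _ = set0)//; apply/seteqP; split => // t /= /esym /eqP.
exact/negP.
Qed.

Lemma simpleZ (a : scalars R k) s : simple_fun s -> simple_fun (a *: s).
Proof. by move=> ss; apply: (simple2 (fun x _ => a *: x) ss ss). Qed.

Lemma simpleD s t : simple_fun s -> simple_fun t -> simple_fun (s + t).
Proof. exact: simple2. Qed.

Lemma strongly_measurable_simple s : simple_fun s -> strongly_measurable s.
Proof.
move=> ss; exists (fun=> s); split => //; apply: aeW => t _; exact: cvg_cst.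
Qed.

Lemma strongly_measurableP (a : scalars R k) f g :
  strongly_measurable f -> strongly_measurable g ->
  strongly_measurable (a *: f + g).
Proof.
move=> [s [ss fs]] [t [st ft]]; exists (fun n => a *: s n + t n); split.
  by move=> n; apply: simpleD => //; exact: simpleZ.
apply: filterS2 fs ft => x fs ft Dx.
by apply: cvgD; [apply: cvgZl_tmp; exact: fs|exact: ft].
Qed.

Lemma strongly_measurableB f g :
  strongly_measurable f -> strongly_measurable g ->
  strongly_measurable (f - g).
Proof.
move=> mf mg; rewrite -scaleN1r addrC; exact: strongly_measurableP.
Qed.

Hypothesis cmu : measure_is_complete mu.
Hypothesis mD : measurable D.
Hypothesis muD : (mu D < +oo)%E.

Lemma measurable_rnorm f : strongly_measurable f ->
  measurable_fun D (fun t => (rnorm (f t))%:E).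
Proof.
move=> [s [ss fs]].
pose h n t : \bar R := (rnorm (s n t))%:E.
apply: (@ae_measurable_fun _ _ _ _ cmu _ (fun t => limn_esup (h ^~ t))).
  apply: filterS fs => t fs Dt.
  have ht : h ^~ t @ \oo --> (rnorm (f t))%:E.
    apply: cvg_EFin; first exact: nearW.
    by apply: (cvg_comp _ _ (fs Dt)); exact: rnorm_continuous.
  by rewrite is_cvg_limn_esupE; [exact/cvg_lim|exact: cvgP ht].
apply: measurable_fun_limn_esup => n _ B mB.
apply: measurableI => //.
exact: (simple_preimage (fun x => (rnorm x)%:E)).
Qed.

Lemma simple_bochner_fin s : simple_fun s ->
  (\int[mu]_(t in D) (rnorm (s t))%:E < +oo)%E.
Proof.
move=> ss; have [M hM] : exists M : R, forall t, rnorm (s t) <= M.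
  have fr : finite_set (range (fun t => rnorm (s t))).
    rewrite (_ : (fun t => _) = rnorm \o s)// -image_comp.
    by apply: finite_image; exact: ss.1.
  have /pinfty_ex_gt0[M _ hM] := compact_bounded (finite_compact fr).
  by exists M => t; rewrite (le_trans (ler_norm _))//; apply: hM; exists t.
apply: (@le_lt_trans _ _ (\int[mu]_(t in D) (`|M|)%:E)%E).
  apply: ge0_le_integral => //.
  - by move=> t _; rewrite lee_fin rnorm_ge0.
  - exact/measurable_rnorm/strongly_measurable_simple.
  - by move=> t _; rewrite lee_fin (le_trans (hM t))// ler_norm.
by rewrite integral_cst// lte_mul_pinfty// lee_fin.
Qed.

Lemma strongly_measurable_le_integralD (a : scalars R k) f g :
  strongly_measurable f -> strongly_measurable g ->
  (\int[mu]_(t in D) (rnorm (a *: f t + g t))%:E <=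
   (reS `|a|)%:E * \int[mu]_(t in D) (rnorm (f t))%:E +
     \int[mu]_(t in D) (rnorm (g t))%:E)%E.
Proof.
move=> mf mg.
rewrite -ge0_integralZl//; last 3 first.
- exact: measurable_rnorm.
- by move=> t _; rewrite lee_fin rnorm_ge0.
- by rewrite lee_fin reS_ge0.
rewrite -ge0_integralD//; last 4 first.
- by move=> t _; rewrite -EFinM lee_fin mulr_ge0 ?reS_ge0 ?rnorm_ge0.
- by apply: measurable_funeM; exact: measurable_rnorm.
- by move=> t _; rewrite lee_fin rnorm_ge0.
- exact: measurable_rnorm.
apply: ge0_le_integral => //.
- by move=> t _; rewrite lee_fin rnorm_ge0.
- exact: (measurable_rnorm (strongly_measurableP _ _ _)).
- apply: emeasurable_funD; last exact: measurable_rnorm.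
  by apply: measurable_funeM; exact: measurable_rnorm.
- by move=> t _; rewrite -EFinM -EFinD lee_fin (le_trans (rnormD _ _))// rnormZ.
Qed.

Lemma bochner_fin f : bochner_integrable f ->
  (\int[mu]_(t in D) (rnorm (f t))%:E < +oo)%E.
Proof.
move=> [mf [s [ss fs]]].
have [n hn] : exists n,
    (\int[mu]_(t in D) (rnorm (f t - s n t))%:E < +oo)%E.
  have [[n _ /(_ n (leqnn n)) /= fn] _] := (fine_cvgP _ _).1 fs.
  by exists n; rewrite ltey_eq fn.
have ms := strongly_measurable_simple (ss n).
have := strongly_measurable_le_integralD 1 (strongly_measurableB mf ms) ms.
rewrite (eq_integral (fun t => (rnorm (f t))%:E)); last first.
  by move=> t _; rewrite scale1r subrK.
move=> /le_lt_trans; apply.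
rewrite lte_add_pinfty ?simple_bochner_fin//.
by rewrite lte_mul_pinfty// lee_fin reS_ge0.
Qed.

Lemma bochner_submod (a : scalars R k) f g :
  bochner_integrable f -> bochner_integrable g ->
  bochner_integrable (a *: f + g).
Proof.
move=> [mf [s [ss fs]]] [mg [t [st gt]]]; split.
  exact: strongly_measurableP.
exists (fun n => a *: s n + t n); split.
  by move=> n; apply: simpleD => //; exact: simpleZ.
apply: (@squeeze_cvge _ _ _ _ (cst 0%E) _ (fun n =>
  (reS `|a|)%:E * \int[mu]_(x in D) (rnorm (f x - s n x))%:E +
     \int[mu]_(x in D) (rnorm (g x - t n x))%:E)%E).
- apply: nearW => n; rewrite integral_ge0 /=; last first.
    by move=> x _; rewrite lee_fin rnorm_ge0.
  have := strongly_measurable_le_integralD a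
    (strongly_measurableB mf (strongly_measurable_simple (ss n)))
    (strongly_measurableB mg (strongly_measurable_simple (st n))).
  apply: le_trans; rewrite le_eqVlt; apply/orP; left; apply/eqP.
  apply: eq_integral => x _; congr (_%:E).
  congr (rnorm _).
  transitivity (a *: f x + g x - (a *: s n x + t n x)) => //.
  by rewrite opprD addrACA -scalerBr.
- exact: cvg_cst.
- rewrite -[X in _ --> X]adde0 -[X in _ --> (X + _)%E](mule0 (reS `|a|)%:E).
  by apply: cvgeD => //; apply: cvgeZl.
Qed.

Lemma bochner0 : bochner_integrable (0 : T -> X).
Proof.
split; first exact/strongly_measurable_simple/simple0.
exists (fun=> 0); split; first by move=> n; exact: simple0.
under eq_fun do under eq_integral do rewrite subrr rnorm0.
by rewrite integral0; exact: cvg_cst.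
Qed.

Lemma EFin_L1norm f : bochner_integrable f ->
  ((L1norm f)%:E = \int[mu]_(t in D) (rnorm (f t))%:E)%E.
Proof.
move=> bf; rewrite fineK// ge0_fin_numE ?bochner_fin//.
by apply: integral_ge0 => t _; rewrite lee_fin rnorm_ge0.
Qed.

Lemma L1normP (a : scalars R k) f g :
  bochner_integrable f -> bochner_integrable g ->
  L1norm (a *: f + g) <= reS `|a| * L1norm f + L1norm g.
Proof.
move=> bf bg; rewrite -lee_fin EFinD EFinM !EFin_L1norm//; last first.
  exact: bochner_submod.
exact: strongly_measurable_le_integralD bf.1 bg.1.
Qed.

Lemma L1normZ (a : scalars R k) f : bochner_integrable f ->
  L1norm (a *: f) = reS `|a| * L1norm f.
Proof.
move=> bf; apply: EFin_inj; rewrite EFinM EFin_L1norm; last first.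
  by rewrite -[a *: f]addr0; apply: bochner_submod => //; exact: bochner0.
rewrite EFin_L1norm// -ge0_integralZl//; first last.
- by rewrite lee_fin reS_ge0.
- by move=> t _; rewrite lee_fin rnorm_ge0.
- exact: measurable_rnorm bf.1.
by apply: eq_integral => t _; rewrite rnormZ.
Qed.

Lemma L1norm_ae_eq f g : bochner_integrable f -> bochner_integrable g ->
  ae_eq mu D f g -> L1norm f = L1norm g.
Proof.
move=> bf bg fg; congr fine; apply: ge0_ae_eq_integral => //.
- exact: measurable_rnorm bf.1.
- exact: measurable_rnorm bg.1.
- by move=> t _; rewrite lee_fin rnorm_ge0.
- by move=> t _; rewrite lee_fin rnorm_ge0.
- by apply: filterS fg => t /[apply] ->.
Qed.

Lemma L1norm_eq0 f : bochner_integrable f -> L1norm f = 0 ->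
  ae_eq mu D f (cst 0).
Proof.
move=> bf f0; have H : ae_eq mu D (fun t => (rnorm (f t))%:E) (cst 0%E).
  apply: (ae_eq_integral_abs mu mD (measurable_rnorm bf.1)).1.
  rewrite -[RHS]/(0%:E) -f0 EFin_L1norm//; apply: eq_integral => t _.
  by rewrite gee0_abs// lee_fin rnorm_ge0.
apply: filterS H => t Ht Dt; apply: rnorm0_eq0; apply: EFin_inj; exact: Ht.
Qed.

End bochner.

Section lebesgue_unit_interval.
Context {R : realType}.

(** [R] with the Lebesgue sigma-field, i.e. the Caratheodory sigma-field of
    Lebesgue outer measure (not only the Borel sets). *)
Definition lebesgue_line : measurableType _ :=
  caratheodory_type ((wlength (@idfun R))^*)%mu.

Definition lebesgue_mu : {measure set lebesgue_line -> \bar R} :=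
  completed_lebesgue_measure.

Definition unit_interval : set lebesgue_line := `[0%R, 1%R]%classic.

Lemma measurable_unit_interval : measurable unit_interval.
Proof.
by apply: sub_caratheodory; exact: measurable_itv.
Qed.

Lemma lebesgue_mu_unit_interval : lebesgue_mu unit_interval = 1%E.
Proof.
have -> : lebesgue_mu unit_interval = lebesgue_measure (`[0%R, 1%R]%classic : set R).
  by [].
by rewrite lebesgue_measure_itv/= lte_fin ltr01 oppr0 adde0.
Qed.

Lemma lebesgue_mu_complete : measure_is_complete lebesgue_mu.
Proof. exact: completed_lebesgue_measure_is_complete. Qed.

End lebesgue_unit_interval.
Arguments lebesgue_line : clear implicits.
Arguments lebesgue_mu : clear implicits.
Arguments unit_interval : clear implicits.

Section L1.
Context {R : realType} {k : scalar_kind} (X : normedModType (scalars R k)).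
Local Notation K := (scalars R k).
Local Notation T := (lebesgue_line R).
Local Notation mu := (lebesgue_mu R).
Local Notation D := (unit_interval R).

Let mD : measurable D := measurable_unit_interval.
Let cmu : measure_is_complete mu := lebesgue_mu_complete.
Let muD : (mu D < +oo)%E.
Proof. by rewrite lebesgue_mu_unit_interval ltry. Qed.

(** Functions on [0,1] are represented by functions on the whole line; only
    their values on [0,1] matter, since integrals and almost everywhere
    statements are restricted to [0,1]. *)
Definition bochner_pred : {pred T -> X} :=
  mem [set f : T -> X | bochner_integrable mu D f].

Lemma bochner_pred_submod_closed : submod_closed bochner_pred.
Proof.
split; first exact/mem_set/bochner0.
move=> a f g /set_mem bf /set_mem bg; apply/mem_set.
exact: (bochner_submod cmu mD).
Qed.

HB.instance Definition _ := GRing.isSubmodClosed.Build _ _ bochner_pred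
  bochner_pred_submod_closed.

Record bochnerType := Bochner {
  bochner_fun :> T -> X ;
  bochner_funP : bochner_fun \in bochner_pred }.

HB.instance Definition _ := [isSub for bochner_fun].
HB.instance Definition _ := [Choice of bochnerType by <:].
HB.instance Definition _ := [SubChoice_isSubLmodule of bochnerType by <:].

Lemma bochnerP (f : bochnerType) : bochner_integrable mu D f.
Proof. exact: set_mem (bochner_funP f). Qed.

Definition ae_eq_bochner (f g : bochnerType) := `[< ae_eq mu D f g >].

Let ae_eq_bochner_refl : reflexive ae_eq_bochner.
Proof. by move=> f; apply/asboolP; exact: ae_eq_refl. Qed.

Let ae_eq_bochner_sym : symmetric ae_eq_bochner.
Proof.
by move=> f g; apply/idP/idP => /asboolP h; apply/asboolP/ae_eq_sym.
Qed.

Let ae_eq_bochner_trans : transitive ae_eq_bochner.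
Proof.
by move=> f g h /asboolP gf /asboolP fh; apply/asboolP/(ae_eq_trans gf fh).
Qed.

Canonical ae_eq_bochner_canonical := EquivRel ae_eq_bochner
  ae_eq_bochner_refl ae_eq_bochner_sym ae_eq_bochner_trans.

Local Open Scope quotient_scope.

Definition L1 : Type := {eq_quot ae_eq_bochner}.
HB.instance Definition _ := Choice.on L1.
HB.instance Definition _ := EqQuotient.on L1.

(** A representative of the class, defined up to almost everywhere equality on
    [0,1]. *)
Definition L1_fun (f : L1) : T -> X := repr f : bochnerType.
Coercion L1_fun : L1 >-> Funclass.

Lemma L1_piP (f g : bochnerType) :
  \pi_L1 f = \pi_L1 g <-> ae_eq mu D f g.
Proof.
split; first by move/eqP; rewrite eqmodE => /asboolP.
by move=> fg; apply/eqP; rewrite eqmodE; apply/asboolP.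
Qed.

Lemma L1_reprP (f : bochnerType) : ae_eq mu D (repr (\pi_L1 f)) f.
Proof. by apply/L1_piP; rewrite reprK. Qed.

Definition L1_add (f g : L1) : L1 := \pi_L1 (repr f + repr g).
Definition L1_opp (f : L1) : L1 := \pi_L1 (- repr f).
Definition L1_scale (a : K) (f : L1) : L1 := \pi_L1 (a *: repr f).

Lemma L1_addE (f g : bochnerType) :
  L1_add (\pi_L1 f) (\pi_L1 g) = \pi_L1 (f + g).
Proof.
apply/L1_piP; apply: filterS2 (L1_reprP f) (L1_reprP g) => t ft gt Dt.
by congr (_ + _); [exact: ft|exact: gt].
Qed.

Lemma L1_oppE (f : bochnerType) : L1_opp (\pi_L1 f) = \pi_L1 (- f).
Proof.
apply/L1_piP; apply: filterS (L1_reprP f) => t ft Dt.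
by congr (- _); exact: ft.
Qed.

Lemma L1_scaleE a (f : bochnerType) : L1_scale a (\pi_L1 f) = \pi_L1 (a *: f).
Proof.
apply/L1_piP; apply: filterS (L1_reprP f) => t ft Dt.
by congr (_ *: _); exact: ft.
Qed.

Let L1_addA : associative L1_add.
Proof.
move=> f g h; rewrite -[f]reprK -[g]reprK -[h]reprK.
move: (repr f) (repr g) (repr h) => {}f {}g {}h.
by rewrite (L1_addE g h) (L1_addE f g) !L1_addE addrA.
Qed.

Let L1_addC : commutative L1_add.
Proof. by move=> f g; rewrite /L1_add addrC. Qed.

Let L1_add0 : left_id (\pi_L1 0 : L1) L1_add.
Proof.
move=> f; rewrite -[f]reprK; move: (repr f) => {}f.
by rewrite L1_addE add0r.
Qed.

Let L1_addN : left_inverse (\pi_L1 0 : L1) L1_opp L1_add.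
Proof.
move=> f; rewrite -[f]reprK; move: (repr f) => {}f.
by rewrite (L1_oppE f) L1_addE addNr.
Qed.

HB.instance Definition _ :=
  GRing.isZmodule.Build L1 L1_addA L1_addC L1_add0 L1_addN.

Let L1_scaleA a b (f : L1) : L1_scale a (L1_scale b f) = L1_scale (a * b) f.
Proof.
rewrite -[f]reprK; move: (repr f) => {}f.
by rewrite (L1_scaleE b f) !L1_scaleE scalerA.
Qed.

Let L1_scale1 : left_id 1 L1_scale.
Proof.
move=> f; rewrite -[f]reprK; move: (repr f) => {}f.
by rewrite L1_scaleE scale1r.
Qed.

Let L1_scaleDr : right_distributive L1_scale +%R.
Proof.
move=> a f g; rewrite -[f]reprK -[g]reprK; move: (repr f) (repr g) => {}f {}g.
rewrite [\pi_L1 f + _]L1_addE (L1_scaleE a f) (L1_scaleE a g) L1_scaleE.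
by rewrite [RHS]L1_addE scalerDr.
Qed.

Let L1_scaleDl (f : L1) : {morph L1_scale^~ f : a b / a + b}.
Proof.
move=> a b; rewrite -[f]reprK; move: (repr f) => {}f.
by rewrite (L1_scaleE a f) (L1_scaleE b f) L1_scaleE [RHS]L1_addE scalerDl.
Qed.

HB.instance Definition _ := GRing.Zmodule_isLmodule.Build K L1
  L1_scaleA L1_scale1 L1_scaleDr L1_scaleDl.

Let nm (f : L1) : K := ofR (L1norm mu D f).

Let nm_pi (f : bochnerType) : nm (\pi_L1 f) = ofR (L1norm mu D f).
Proof.
congr ofR; apply: (L1norm_ae_eq cmu mD); [exact: bochnerP..|exact: L1_reprP].
Qed.

Let nmD (f g : L1) : nm (f + g) <= nm f + nm g.
Proof.
rewrite -[f]reprK -[g]reprK; move: (repr f) (repr g) => {}f {}g.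
rewrite [\pi_L1 _ + _]L1_addE !nm_pi -ofRD ler_ofR.
have := L1normP cmu mD muD 1 (bochnerP f) (bochnerP g).
have -> : reS `|1 : K| = 1 by rewrite normr1; case: (k).
by rewrite mul1r scale1r.
Qed.

Let nmZ (a : K) (f : L1) : nm (a *: f) = `|a| * nm f.
Proof.
rewrite -[f]reprK; move: (repr f) => {}f.
rewrite [_ *: _]L1_scaleE !nm_pi -[`|a|]reSK// -ofRM.
by congr ofR; exact: (L1normZ cmu mD muD a (bochnerP f)).
Qed.

Let nm0 (f : L1) : nm f = 0 -> f = 0.
Proof.
rewrite -[f]reprK; move: (repr f) => {}f.
rewrite nm_pi -ofR0 => /(can_inj (@ofRK R k)) f0.
by apply/L1_piP; apply: (L1norm_eq0 cmu mD muD) => //; exact: bochnerP.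
Qed.

HB.instance Definition _ := @Lmodule_isNormed.Build K L1 nm nmD nmZ nm0.

Lemma L1_norm_pi (f : bochnerType) :
  `|\pi_L1 f : L1| = ofR (L1norm mu D f).
Proof. exact: nm_pi. Qed.

Lemma L1_normE (f : L1) :
  `|f| = ofR (fine (\int[mu]_(t in D) (rnorm (f t))%:E)).
Proof. by []. Qed.

End L1.

(* Main.v *)
Require Import Defs.
From HB Require Import structures.
From mathcomp Require Import all_boot all_order all_algebra.
From mathcomp Require Import all_classical all_reals all_analysis measurable_realfun.
From mathcomp Require Import ring lra.
From mathcomp.real_closed Require Import complex.

Set Implicit Arguments.
Unset Strict Implicit.
Unset Printing Implicit Defensive.

Import Order.TTheory GRing.Theory Num.Theory.
Import numFieldNormedType.Exports.

Local Open Scope classical_set_scope.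
Local Open Scope ring_scope.

(** Multiplication by the indicator of a measurable set A is an L-projection P
    of L^1, i.e. [|g| = |P g| + |g - P g|]. Hence two states phi, psi of f can be
    spliced: [psi + (phi - psi) o P] is again a state of f. If theta = phi - psi
    is nonzero, then subadditivity over a partition of [0,1] forces theta to
    stay large, in norm, on functions supported in arbitrarily small intervals
    around some point s. Splicing along the intervals of radius 1/n around s
    gives states that tend to psi pointwise but stay away from psi in norm, so
    the state space is not compact. Existence of a state is Hahn-Banach. *)

(** * The real Hahn-Banach theorem, by Zorn's lemma on graphs *)

Section hahn_banach.
Context {R : realType} {E : lmodType R} (p : E -> R).
Hypothesis pD : forall x y, p (x + y) <= p x + p y.
Hypothesis pZ : forall (a : R) x, 0 <= a -> p (a *: x) = a * p x.

(** Partial linear functionals are represented by their graphs in [E * R]. *)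
Definition dominated_graph (G : set (E * R)) :=
  (forall (a : R) z w, G z -> G w -> G (a *: z.1 + w.1, a * z.2 + w.2)) /\
  (forall z, G z -> z.2 <= p z.1).

(** Two points of [G] over the same [x] differ by a point over 0, whose second coordinate is at most
    [p 0 = 0]; exchanging them gives equality. *)
Lemma dominated_graph_functional G x r s : dominated_graph G ->
  G (x, r) -> G (x, s) -> r = s.
Proof.
move=> [Glin Gp].
have le r' s' : G (x, r') -> G (x, s') -> s' <= r'.
  move=> Gr Gs; have /= := Gp _ (Glin (-1) _ _ Gr Gs).
  rewrite scaleN1r addNr -(scale0r x) pZ// mul0r; lra.
by move=> Gr Gs; apply/eqP; rewrite eq_le !le.
Qed.

(** For negative [t], subadditivity gives [0 <= p (t *: x0) + p (- t *: x0)], and the last term is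
    [- t * p x0]. *)
Lemma dominated_graph_line x0 :
  dominated_graph [set z | exists t : R, z = (t *: x0, t * p x0)].
Proof.
split=> [a z w [t ->] [s ->]|z [t ->]] /=.
  by exists (a * t + s); rewrite scalerDl scalerA mulrDl mulrA.
have [t0|t0] := leP 0 t; first by rewrite pZ.
have : p (t *: x0 + (- t) *: x0) = 0.
  by rewrite -scalerDl subrr pZ// mul0r.
have := pD (t *: x0) (- t *: x0); rewrite (pZ x0 (_ : 0 <= - t)); last lra.
lra.
Qed.

Definition extended_graph (G : set (E * R)) (y : E) (c : R) :=
  [set z | exists w t, G w /\ z = (w.1 + t *: y, w.2 + t * c)].

(** The value [c] at [y] must lie above every [z.2 - p (z.1 - y)] and below every
    [p (w.1 + y) - w.2]. Subadditivity puts the first family below the second, and [c] is the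
    supremum of the first. *)
Lemma dominated_graph_extend G y : G !=set0 -> dominated_graph G ->
  exists c, dominated_graph (extended_graph G y c).
Proof.
move=> [z0 Gz0] [Glin Gp].
have GD z w : G z -> G w -> G (z.1 + w.1, z.2 + w.2).
  by move=> Gz Gw; have := Glin 1 _ _ Gz Gw; rewrite scale1r mul1r.
have G0 : G (0, 0).
  by have := Glin (-1) _ _ Gz0 Gz0; rewrite scaleN1r mulN1r !addNr.
have GZ (a : R) z : G z -> G (a *: z.1, a * z.2).
  by move=> Gz; have := Glin a _ _ Gz G0; rewrite !addr0.
pose A := [set z.2 - p (z.1 - y) | z in G].
have Aub w : G w -> ubound A (p (w.1 + y) - w.2).
  move=> Gw _ [z Gz <-]; have /= := Gp _ (GD _ _ Gz Gw).
  have := pD (z.1 - y) (w.1 + y); rewrite addrCA subrK addrC; lra.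
have lec z : G z -> z.2 - p (z.1 - y) <= sup A.
  by move=> Gz; apply: ub_le_sup; [exists (p (z0.1 + y) - z0.2); exact: Aub|exists z].
have cle w : G w -> sup A <= p (w.1 + y) - w.2.
  by move=> Gw; apply: ge_sup; [exists (z0.2 - p (z0.1 - y)), z0|exact: Aub].
exists (sup A); split=> [a _ _ [z [t [Gz ->]]] [w [s [Gw ->]]]|_ [z [t [Gz ->]]]] /=.
  exists (a *: z.1 + w.1, a * z.2 + w.2), (a * t + s); split; first exact: Glin.
  congr (_, _); last by rewrite /=; ring.
  by rewrite /= scalerDr scalerDl scalerA addrACA.
have [->|t0] := eqVneq t 0; first by rewrite scale0r mul0r !addr0; exact: Gp.
(* Dividing by the absolute value of [t] reduces to coefficient 1 or -1 at [y], that is, to the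
   upper or the lower bound on [c]. *)
have [tp|tn] : 0 < t \/ t < 0 by apply/orP; rewrite -neq_lt eq_sym.
- have /= := cle _ (GZ t^-1 _ Gz); rewrite lerBrDr -(ler_pM2l tp).
  by rewrite -(pZ _ (ltW tp)) scalerDr scalerA mulrDr mulrA divff// scale1r mul1r addrC.
- have tN : 0 < - t by rewrite oppr_gt0.
  have /= := lec _ (GZ (- t)^-1 _ Gz); rewrite lerBlDr -(ler_pM2l tN) mulrDr.
  rewrite -(pZ _ (ltW tN)) scalerBr scalerA mulrA divff ?gt_eqF// scale1r mul1r.
  by rewrite scaleNr opprK mulNr; lra.
Qed.

Theorem hahn_banach (x0 : E) : exists u : E -> R,
  [/\ forall (a : R) x y, u (a *: x + y) = a * u x + u y,
      forall x, u x <= p x & u x0 = p x0].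
Proof.
(* The prescribed value at [x0] is asked of nonempty graphs only, because the union of the empty
   chain must satisfy [P] too. *)
pose P (G : set (E * R)) := dominated_graph G /\ (G !=set0 -> G (x0, p x0)).
have [|G [[dG Gx0] Gmax]] := @Zorn_bigcup _ P.
  move=> F FP totF; split; first split=> [a z w [X FX Xz] [Y FY Yw]|z [X FX Xz]].
  - have [XY|YX] := totF _ _ FX FY.
    + by exists Y => //; apply: (FP _ FY).1.1 => //; exact: XY.
    + by exists X => //; apply: (FP _ FX).1.1 => //; exact: YX.
  - by apply: (FP _ FX).1.2.
  - by move=> [z [X FX Xz]]; exists X => //; apply: (FP _ FX).2; exists z.
(* The empty graph is not maximal: the line through [(x0, p x0)] properly contains it. *)
have {Gx0} Gx0 : G (x0, p x0).
  apply: contrapT => nG; have G0 : G = set0.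
    by apply/eqP; apply: contra_notT nG => /set0P; exact: Gx0.
  apply: (Gmax [set z | exists t : R, z = (t *: x0, t * p x0)]).
    rewrite G0; split=> // /(_ (0, 0)); apply; exists 0.
    by rewrite scale0r mul0r.
  split; first exact: dominated_graph_line.
  by move=> _; exists 1; rewrite scale1r mul1r.
have Gn0 : G !=set0 by exists (x0, p x0).
have Gtot y : exists r, G (y, r).
  apply: contrapT => nGy; have [c dGc] := dominated_graph_extend y Gn0 dG.
  have subG : G `<=` extended_graph G y c.
    by move=> [x r] Gz; exists (x, r), 0; rewrite scale0r mul0r !addr0.
  apply: (Gmax (extended_graph G y c)); last by split=> // _; exact: subG.
  split=> // /(_ (y, c)); apply: contra_not nGy => h; exists c; apply: h.
  exists (0, 0), 1; rewrite scale1r mul1r !add0r; split => //.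
  by have := dG.1 (-1) _ _ Gx0 Gx0; rewrite scaleN1r mulN1r !addNr.
have [u Gu] := choice Gtot; exists u; split.
- move=> a x y; apply: (dominated_graph_functional dG (Gu _)).
  exact: (dG.1 a (x, u x) (y, u y)).
- by move=> x; exact: (dG.2 (x, u x)).
- exact: dominated_graph_functional dG (Gu _) Gx0.
Qed.

End hahn_banach.

(** * Real parts of scalars and norming functionals over both scalar fields *)

Section scalars_extra.
Context {R : realType} {k : scalar_kind}.
Local Notation K := (scalars R k).

Lemma reSD (x y : K) : reS (x + y) = reS x + reS y.
Proof. by case: k x y => // -[a b] [c d]. Qed.

Lemma ofR1 : (ofR 1 : K) = 1.
Proof. by case: k. Qed.

Lemma reS1 : reS (1 : K) = 1.
Proof. by rewrite -ofR1 ofRK. Qed.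

Lemma reS_le_norm (z : K) : reS z <= reS `|z|.
Proof.
case: k z => [x|[a b]] /=; first exact: ler_norm.
by rewrite (le_trans (ler_norm a))// -sqrtr_sqr ler_wsqrtr// lerDl sqr_ge0.
Qed.

(** A modulus not exceeding the real part leaves no room for an imaginary part. This upgrades
    equalities of real parts to equalities of scalars. *)
Lemma reS_norm_le (z : K) : reS `|z| <= reS z -> z = ofR (reS z).
Proof.
case: k z => // -[a b] /= na; congr (_ +i* _)%C.
have a0 : 0 <= a by apply: le_trans na; exact: sqrtr_ge0.
have : a ^+ 2 + b ^+ 2 <= a ^+ 2.
  rewrite -[leLHS]sqr_sqrtr ?addr_ge0 ?sqr_ge0//.
  by rewrite ler_pXn2r ?nnegrE ?sqrtr_ge0.
rewrite gerDl => b0; apply/eqP; rewrite -sqrf_eq0 eq_le b0 sqr_ge0//.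
Qed.

Lemma ofR_gt0 (x : R) : (0 < (ofR x : K)) = (0 < x).
Proof. by rewrite !lt_def -{1 2}(@ofR0 R k) (can_eq ofRK) ler_ofR. Qed.

End scalars_extra.

Lemma rnorm_gt0 {R : realType} {k : scalar_kind} {E : normedModType (scalars R k)}
  (x : E) : (0 < rnorm x) = (x != 0).
Proof.
rewrite lt_def rnorm_ge0 andbT; apply/idP/idP; apply: contra_neq.
  by move=> ->; rewrite rnorm0.
exact: rnorm0_eq0.
Qed.

(** Restricting scalars along [ofR] makes [E] a real vector space on which [rnorm] is sublinear, so
    one real theorem serves both fields. *)
Lemma hahn_banach_rnorm {R : realType} {k : scalar_kind}
    {E : normedModType (scalars R k)} (e : E) : exists u : E -> R,
  [/\ forall a x y, u (ofR a *: x + y) = a * u x + u y,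
      forall x, u x <= rnorm x & u e = rnorm e].
Proof.
pose K := scalars R k.
have sA a b (x : E) : (ofR a : K) *: ((ofR b : K) *: x) = (ofR (a * b) : K) *: x.
  by rewrite scalerA -ofRM.
have s1 (x : E) : (ofR 1 : K) *: x = x by rewrite ofR1 scale1r.
have sDr (a : R) (x y : E) : (ofR a : K) *: (x + y) = (ofR a : K) *: x + (ofR a : K) *: y.
  exact: scalerDr.
have sDl (x : E) : {morph (fun a : R => (ofR a : K) *: x) : a b / a + b}.
  by move=> a b; rewrite -scalerDl -ofRD.
pose ER : lmodType R := HB.pack (GRing.Zmodule.sort E)
  (GRing.Zmodule_isLmodule.Build R E sA s1 sDr sDl).
apply: (@hahn_banach R ER rnorm) => [x y|a x a0]; first exact: rnormD.
by rewrite /GRing.scale/= rnormZ ger0_norm ?ofRK// -(@ofR0 R k) ler_ofR.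
Qed.

Lemma unimodular_rotation {R : realType} (z : R[i]) :
  exists2 w : R[i], `|w| = 1 & w * z = `|z|.
Proof.
have [->|z0] := eqVneq z 0; first by exists 1; rewrite ?normr1// mulr0 normr0.
exists (`|z| / z); last by rewrite divfK.
by rewrite normrM normfV normr_id divff// normr_eq0.
Qed.

Lemma hahn_banach_functional {R : realType} {k : scalar_kind}
    {E : normedModType (scalars R k)} (e : E) : exists phi : E -> (scalars R k)^o,
  [/\ linear phi, forall x, rnorm (phi x) <= rnorm x & phi e = `|e|].
Proof.
case: k E e => E e; have [u [ulin ule ue]] := hahn_banach_rnorm e.
  exists u; split=> // x; rewrite /rnorm/= ler_norml ule andbT.
  have := ule (- x); rewrite rnormN lerNl; congr (_ <= _).
  have u0 : u 0 = 0 by have := ulin (-1) 0 0; rewrite scaler0 addr0; lra.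
  by have := ulin (-1) x 0; rewrite /= scaleN1r addr0 u0; lra.
have uD x y : u (x + y) = u x + u y.
  by have := ulin 1 x y; rewrite scale1r mul1r.
have u0 : u 0 = 0 by have := uD 0 0; rewrite addr0; lra.
have uZ a x : u (a%:C%C *: x) = a * u x.
  by have := ulin a x 0; rewrite u0 !addr0.
(* A complex functional is recovered from its real part: phi(x) = u(x) - i u(ix). *)
pose phi x : (scalars R ComplexScalars)^o := (u x +i* - u ('i%C *: x))%C.
have iZ (a : R) x : 'i%C *: (a%:C%C *: x) = a%:C%C *: ('i%C *: x).
  by rewrite !scalerA mulrC.
have ii x : 'i%C *: ('i%C *: x) = (-1)%:C%C *: x.
  by rewrite scalerA; congr (_ *: _); simpc.
have plin : linear phi.
  move=> [a1 a2] x y; rewrite /phi.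
  have -> : (a1 +i* a2)%C *: x = a1%:C%C *: x + a2%:C%C *: ('i%C *: x).
    by rewrite scalerA -scalerDl; congr (_ *: _); simpc.
  rewrite !scalerDr !iZ ii !uD !uZ.
  by apply/eqP; rewrite eq_complex /=; apply/andP; split; apply/eqP; ring.
(* Rotating [x] by a unimodular [w] makes [phi (w *: x)] the modulus of [phi x]; being real, it
   equals [u (w *: x)], which is bounded by the norm of [x]. *)
have phile x : rnorm (phi x) <= rnorm x.
  have [w w1 wz] := unimodular_rotation (phi x).
  have phi0 : phi 0 = 0 by rewrite /phi scaler0 u0 oppr0.
  have : phi (w *: x) = `|phi x|.
    by have := plin w x 0; rewrite phi0 !addr0 => ->; exact: wz.
  move/(congr1 (@complex.Re R)) => /= h.
  rewrite /rnorm/= -[leLHS]h; apply: (le_trans (ule _)).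
  by rewrite rnormZ w1 reS1 mul1r.
exists phi; split => //.
(* The real part of [phi e] is [u e], already the norm of [e] and hence a bound for the modulus, so
   [phi e] is real. *)
rewrite -rnormE -ue; apply: (@reS_norm_le R ComplexScalars).
by have := phile e; rewrite -ue.
Qed.

Lemma rnorm_eq1 {R : realType} {k : scalar_kind} {E : normedModType (scalars R k)}
  (x : E) : (rnorm x = 1) <-> (`|x| = 1).
Proof. by rewrite -rnormE; split=> [->|/(congr1 (@reS R k))]; rewrite ?ofR1 ?ofRK ?reS1. Qed.

(** * State spaces, L-projections and splicing *)

Section states.
Context {R : realType} {k : scalar_kind} {E : normedModType (scalars R k)}.
Local Notation K := (scalars R k).

Lemma bounded_dual (phi : E -> K^o) (C : R) : linear phi ->
  (forall x, rnorm (phi x) <= C * rnorm x) -> exists psi : dual E, psi =1 phi.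
Proof.
move=> lphi phiC; suff h : phi \in @continuous_linear R k E by exists (Dual h).
apply/mem_set; split => //.
pose f : {linear E -> K^o} :=
  HB.pack phi (GRing.isLinear.Build _ _ _ _ _ lphi).
apply: (@linear_bounded_continuous _ _ _ f).1.
apply/linear_boundedP; exists (ofR `|C|); split; first by rewrite realE -ofR0 ler_ofR normr_ge0.
move=> M CM x; rewrite -(rnormE (f x)) -(rnormE x).
apply: (@le_trans _ _ (ofR `|C| * ofR (rnorm x))).
  rewrite -ofRM ler_ofR (le_trans (phiC x))// ler_wpM2r ?rnorm_ge0//.
  exact: ler_norm.
by rewrite ler_wpM2r ?rnormE// ltW.
Qed.

(** For a contractive functional, real part 1 at a unit vector forces the value 1, and the operator
    norm is then attained at [e]. New states can thus be recognised by inequalities and real parts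
    alone. *)
Lemma state_spaceP (e : E) (phi : dual E) : `|e| = 1 ->
  state_space e phi <->
  (forall x, rnorm (phi x) <= rnorm x) /\ reS (phi e) = 1.
Proof.
move=> e1; split=> [[phi1 phie]|[phile phie]].
  split=> [x|]; last by rewrite phie reS1.
  apply: (le_trans (dual_normP phi x)).
  by rewrite -[leRHS]mul1r -(@ofRK R k (dual_norm phi)) [ofR _]phi1 reS1.
have phie1 : phi e = 1.
  rewrite -ofR1 -phie; apply: reS_norm_le; rewrite phie.
  by have := phile e; rewrite (rnorm_eq1 e).2.
split=> //; rewrite -[`|phi|]/(ofR (dual_norm phi)) -ofR1; congr ofR; apply/eqP; rewrite eq_le.
apply/andP; split.
  apply: dual_norm_le => x x1; apply: (le_trans (phile x)).
  by rewrite -(@ler_ofR _ k) rnormE ofR1.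
apply: (@le_trans _ _ (rnorm (phi e))).
  by rewrite phie1 /rnorm normr1 reS1.
by apply: dual_norm_ub; rewrite e1.
Qed.

Lemma state_space_nonempty (e : E) : `|e| = 1 -> state_space e !=set0.
Proof.
move=> e1; have [phi [lphi phile phie]] := hahn_banach_functional e.
have [|psi psiE] := @bounded_dual phi 1 lphi.
  by move=> x; rewrite mul1r.
exists psi; apply/(state_spaceP _ e1); split=> [x|]; rewrite psiE//.
by rewrite phie e1 reS1.
Qed.

Lemma dual_linear (phi : dual E) : linear phi.
Proof. by have [] := set_mem (dual_funP phi). Qed.

Definition Lprojection (P : E -> E) := [/\ linear P, P \o P =1 P &
  forall x, rnorm x = rnorm (P x) + rnorm (x - P x)].

(** The splice uses [phi] on the range of [P] and [psi] on the complement. It is contractive because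
    norms add over the two summands. *)
Lemma state_space_splice (e : E) (phi psi : dual E) (P : E -> E) :
  `|e| = 1 -> Lprojection P -> state_space e phi -> state_space e psi ->
  exists2 chi : dual E, state_space e chi &
    forall x, chi x = psi x + (phi - psi) (P x).
Proof.
move=> e1 [Plin PP PL] /(state_spaceP _ e1)[phile phie] /(state_spaceP _ e1)[psile psie].
pose f x : K^o := phi (P x) + psi (x - P x).
have flin : linear f.
  move=> a x y; rewrite /f Plin dual_linear opprD addrACA -scalerBr dual_linear.
  by rewrite scalerDr addrACA.
have fle x : rnorm (f x) <= rnorm x.
  by rewrite (PL x) (le_trans (rnormD _ _))// lerD.
have [|chi chiE] := @bounded_dual f 1 flin.
  by move=> x; rewrite mul1r.
exists chi; last first.
  move=> x; rewrite chiE /f /=.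
  have -> : psi (x - P x) = psi x - psi (P x).
    by rewrite addrC -scaleN1r dual_linear scaleN1r addrC.
  by rewrite addrA addrAC addrC addrA.
apply/(state_spaceP _ e1); split=> [x|]; first by rewrite chiE.
(* A state norms each L-summand of [e]: the two real parts sum to 1, as do the two norms, and
   neither real part exceeds its norm. *)
have ge (eta : dual E) x : reS (eta e) = 1 -> (forall y, rnorm (eta y) <= rnorm y) ->
    rnorm e = rnorm x + rnorm (e - x) -> rnorm x <= reS (eta x).
  move=> etae etale ex; have etaD : eta e = eta x + eta (e - x).
    by have := dual_linear eta 1 x (e - x); rewrite !scale1r addrCA subrr addr0.
  have := congr1 (@reS R k) etaD; rewrite reSD etae.
  have := le_trans (reS_le_norm (eta (e - x))) (etale (e - x)).
  by move: ex; rewrite (rnorm_eq1 e).2//; lra.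
apply/eqP; rewrite chiE eq_le; apply/andP; split.
  by rewrite -((rnorm_eq1 e).2 e1) (le_trans (reS_le_norm _))//; exact: fle.
rewrite /f reSD -((rnorm_eq1 e).2 e1) (PL e) lerD//; apply: ge => //.
by rewrite subKr addrC.
Qed.

Lemma near_dual (p : dual E) (eps : R) : 0 < eps ->
  \forall q \near p, dual_norm (q - p) < eps.
Proof.
move=> eps0; have /cvgr_dist_lt := @cvg_id _ (nbhs p).
move=> /(_ (ofR eps)); rewrite ofR_gt0 => /(_ eps0); apply: filterS => q.
rewrite distrC -[`|_|]/(ofR _) !lt_neqAle ler_ofR => /andP[h ->].
by rewrite andbT; apply: contra_neq h => ->.
Qed.

(** By compactness the splices along [P_ n] have a norm cluster point. Their pointwise convergence
    identifies it as [psi], while the last hypothesis keeps every splice at distance more than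
    [delta] from [psi]. *)
Lemma compact_states_unique (e : E) (phi psi : dual E) (P_ : nat -> E -> E)
    (delta : R) :
  `|e| = 1 -> compact (state_space e) ->
  state_space e phi -> state_space e psi -> (forall n, Lprojection (P_ n)) ->
  (forall x, rnorm (P_ n x) @[n --> \oo] --> 0) ->
  0 < delta ->
  ~ (forall n, exists x, delta * rnorm (P_ n x) < rnorm ((phi - psi) (P_ n x))).
Proof.
move=> e1 cS Sphi Spsi LP P0 delta0 big.
pose theta := phi - psi.
have /choice[chi_ chi_P] n : exists chi, state_space e chi /\
    forall x, chi x = psi x + theta (P_ n x).
  by have [chi Schi chiE] := state_space_splice e1 (LP n) Sphi Spsi; exists chi.
have [p [Sp clp]] : state_space e `&` cluster (chi_ @ \oo) !=set0.
  by by apply: cS; exists 0%N => // n _; exact: (chi_P n).1.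
have ppsi : p = psi.
  apply/val_inj/funext => x /=; apply/eqP; rewrite -subr_eq0; apply/eqP/rnorm0_eq0.
  apply/eqP; rewrite eq_le rnorm_ge0 andbT; apply/ler_addgt0Pl => eps eps0.
  have nx0 : 0 < rnorm x + 1 by have := rnorm_ge0 x; lra.
  have d0 := dual_norm_ge0 theta.
  have nd0 : 0 < dual_norm theta + 1 by lra.
  (* Clustering supplies one [q] close to [psi] at [x] and close to [p] in norm, each gap costing
     [eps / 2]. The added 1 keeps the denominators positive. *)
  have [] := clp [set q | rnorm (q x - psi x) < eps / 2]
                 [set q | dual_norm (q - p) < eps / 2 / (rnorm x + 1)].
  - have e2 : 0 < eps / 2 / (dual_norm theta + 1) by rewrite !divr_gt0.
    have /cvgrPdist_lt /(_ _ e2) nP := P0 x.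
    apply: filterS nP => n /=; rewrite sub0r normrN => nP.
    rewrite (chi_P n).2 addrC addKr (le_lt_trans (dual_normP _ _))//.
    rewrite ger0_norm ?rnorm_ge0// ltr_pdivlMr// in nP.
    apply: le_lt_trans nP; rewrite mulrC ler_wpM2l ?rnorm_ge0//; lra.
  - by apply: near_dual; rewrite !divr_gt0.
  move=> q [/= qpsi qp].
  have -> : p x - psi x = - ((q - p) x) + (q x - psi x).
    by rewrite opprB addrA subrK.
  rewrite addr0 (le_trans (rnormD _ _))// [leRHS]splitr lerD ?ltW// rnormN.
  rewrite ltr_pdivlMr// in qp; apply: le_lt_trans qp.
  apply: le_trans (dual_normP _ _) _; rewrite ler_wpM2l ?dual_norm_ge0//; lra.
(* By idempotence [chi_ n - p] agrees with [theta] at [P_ n x], so a splice within [delta] of [p]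
   contradicts [big]. *)
have [] := clp (range chi_) [set q | dual_norm (q - p) < delta].
- by exists 0%N => // n _; exists n.
- exact: near_dual.
move=> _ [[n _ <-] /= chip]; have [x] := big n; apply/negP; rewrite -leNgt.
have [_ PP _] := LP n; have := (chi_P n).2 (P_ n x); rewrite -[P_ n (P_ n x)]/((P_ n \o P_ n) x) PP.
move=> h; have <- : (chi_ n - p) (P_ n x) = theta (P_ n x).
  by rewrite -[LHS]/(chi_ n (P_ n x) - p (P_ n x)) h ppsi addrC addKr.
by apply: le_trans (dual_normP _ _) _; rewrite ler_wpM2r ?rnorm_ge0// ltW.
Qed.

End states.

(** * Multiplication of vector-valued functions by an indicator *)

Definition cutoff {T : Type} {V : nmodType} (A : set T) (f : T -> V) : T -> V :=
  patch (fun=> 0) A f.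

Lemma cutoff_in {T : Type} {V : nmodType} (A : set T) (f : T -> V) t :
  A t -> cutoff A f t = f t.
Proof. by move=> At; rewrite /cutoff /patch mem_set. Qed.

Lemma cutoff_out {T : Type} {V : nmodType} (A : set T) (f : T -> V) t :
  ~ A t -> cutoff A f t = 0.
Proof. by move=> At; rewrite /cutoff /patch memNset. Qed.

Section cutoff.
Context {R : realType} {k : scalar_kind} {X : normedModType (scalars R k)}.
Context {d} {T : measurableType d} (mu : {measure set T -> \bar R}) (D : set T).
Hypothesis cmu : measure_is_complete mu.
Hypothesis mD : measurable D.
Implicit Types (A : set T) (f g s : T -> X).

Lemma simple_cutoff A s : measurable A -> simple_fun s -> simple_fun (cutoff A s).
Proof.
move=> mA [fs ms]; split.
  apply: (@sub_finite_set _ _ (range s `|` [set 0])); last by rewrite finite_setU.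
  by move=> _ [t _ <-]; rewrite /cutoff/patch; case: ifP => _; [left; exists t|right].
move=> x.
rewrite (_ : _ @^-1` _ = (A `&` s @^-1` [set x]) `|` (~` A `&` [set t | 0 = x])).
  apply: measurableU; apply: measurableI => //; first exact: measurableC.
  have [x0|x0] := pselect (0 = x).
    by rewrite (_ : [set t | _] = setT)//; apply/seteqP; split.
  by rewrite (_ : [set t | _] = set0)//; apply/seteqP; split.
apply/seteqP; split=> t /=.
  by have [At|At] := pselect (A t); [rewrite cutoff_in//; left|rewrite cutoff_out//; right].
by move=> [[At <-]|[nAt <-]]; [rewrite cutoff_in|rewrite cutoff_out].
Qed.

Lemma strongly_measurable_cutoff A f : measurable A ->
  strongly_measurable mu D f -> strongly_measurable mu D (cutoff A f).
Proof.
move=> mA [s [ss sf]]; exists (fun n => cutoff A (s n)); split.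
  by move=> n; exact: simple_cutoff.
apply: filterS sf => t st Dt; rewrite /cutoff/patch; case: ifP => _; first exact: st.
exact: cvg_cst.
Qed.

(** Cutting off [f] and its simple approximants alike does not increase the pointwise distance
    between them, so the error integrals are squeezed to 0. *)
Lemma bochner_cutoff A f : measurable A ->
  bochner_integrable mu D f -> bochner_integrable mu D (cutoff A f).
Proof.
move=> mA [mf [s [ss sf]]]; split; first exact: strongly_measurable_cutoff.
exists (fun n => cutoff A (s n)); split; first by move=> n; exact: simple_cutoff.
have ms n := strongly_measurable_simple mu D (ss n).
have msA n := strongly_measurable_simple mu D (simple_cutoff mA (ss n)).
have mfA := strongly_measurable_cutoff mA mf.
apply: (@squeeze_cvge _ _ _ _ (cst 0%E) _ _ _ _ _ sf); last exact: cvg_cst.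
apply: nearW => n; rewrite integral_ge0 => [|t _]; last by rewrite lee_fin rnorm_ge0.
apply: ge0_le_integral => //.
- by move=> t _; rewrite lee_fin rnorm_ge0.
- exact/(measurable_rnorm cmu mD)/strongly_measurableB.
- exact/(measurable_rnorm cmu mD)/strongly_measurableB.
- move=> t _; rewrite lee_fin /cutoff/patch; case: ifP => // _.
  by rewrite subrr rnorm0 rnorm_ge0.
Qed.

End cutoff.

(** * Indicator cutoffs as operators on L^1 *)

Section L1_cutoff.
Context {R : realType} {k : scalar_kind} {X : normedModType (scalars R k)}.
Local Notation T := (lebesgue_line R).
Local Notation mu := (lebesgue_mu R).
Local Notation D := (unit_interval R).
Implicit Types (A B : set T) (g h : L1 X).

Let mD : measurable D := measurable_unit_interval.
Let cmu : measure_is_complete mu := lebesgue_mu_complete.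
Let muD : (mu D < +oo)%E.
Proof. by rewrite lebesgue_mu_unit_interval ltry. Qed.

Lemma L1_ext g h : ae_eq mu D g h -> g = h.
Proof. by move=> gh; rewrite -[g]reprK -[h]reprK; apply/L1_piP. Qed.

Lemma L1_fun_addZ a g h : ae_eq mu D (a *: g + h : L1 X) (fun t => a *: g t + h t).
Proof.
rewrite -[g]reprK -[h]reprK [a *: _]L1_scaleE [_ + _]L1_addE !reprK.
exact: L1_reprP.
Qed.

Lemma L1_funB g h : ae_eq mu D (g - h : L1 X) (fun t => g t - h t).
Proof.
rewrite addrC -scaleN1r; apply: filterS (L1_fun_addZ (-1) h g) => t /[apply] ->.
by rewrite scaleN1r addrC.
Qed.

Lemma L1_rnormE g : ((rnorm g)%:E = \int[mu]_(t in D) (rnorm (g t))%:E)%E.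
Proof. by rewrite -(EFin_L1norm cmu mD muD (bochnerP (repr g))) /rnorm ofRK. Qed.

Lemma L1_measurable_rnorm g : measurable_fun D (fun t => (rnorm (g t))%:E).
Proof. exact/(measurable_rnorm cmu mD)/(bochnerP (repr g)).1. Qed.

Definition L1_cutoff A (mA : measurable A) g : L1 X :=
  \pi_(L1 X)%qT (Bochner (mem_set (bochner_cutoff cmu mD mA (bochnerP (repr g))))).

Lemma L1_cutoffE A (mA : measurable A) g :
  ae_eq mu D (L1_cutoff mA g) (cutoff A g).
Proof. exact: L1_reprP. Qed.

(** At almost every point one of the two pieces of [g] vanishes and the other equals [g], so the
    norms already add pointwise, before integration. *)
Lemma L1_cutoff_Lprojection A (mA : measurable A) :
  Lprojection (L1_cutoff mA).
Proof.
split=> [a g h|g|g].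
- apply/L1_ext/(ae_eq_trans (L1_cutoffE mA _))/ae_eq_sym.
  apply: (ae_eq_trans (L1_fun_addZ _ _ _)).
  apply: filterS3 (L1_cutoffE mA g) (L1_cutoffE mA h) (L1_fun_addZ a g h).
  move=> t cg ch gh Dt; rewrite cg// ch//; have [At|At] := pselect (A t).
    by rewrite !cutoff_in// gh.
  by rewrite !cutoff_out// scaler0 addr0.
- apply: L1_ext.
  apply: filterS2 (L1_cutoffE mA g) (L1_cutoffE mA (L1_cutoff mA g)) => t cg cc Dt.
  rewrite /= cc//; have [At|At] := pselect (A t); first by rewrite cutoff_in.
  by rewrite cg// !cutoff_out.
- apply: EFin_inj; rewrite EFinD !L1_rnormE -ge0_integralD//; first last.
  + exact: L1_measurable_rnorm.
  + by move=> t _; rewrite lee_fin rnorm_ge0.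
  + exact: L1_measurable_rnorm.
  + by move=> t _; rewrite lee_fin rnorm_ge0.
  apply: ge0_ae_eq_integral => //.
  + exact: L1_measurable_rnorm.
  + by apply: emeasurable_funD; exact: L1_measurable_rnorm.
  + by move=> t _; rewrite lee_fin rnorm_ge0.
  + by move=> t _; rewrite -EFinD lee_fin addr_ge0 ?rnorm_ge0.
  apply: filterS2 (L1_cutoffE mA g) (L1_funB g (L1_cutoff mA g)) => t cg Bg Dt.
  rewrite Bg// cg// /cutoff /patch -EFinD; case: ifP => _.
    by rewrite subrr rnorm0 addr0.
  by rewrite subr0 rnorm0 add0r.
Qed.

(** Dominated convergence, with the pointwise norm of [g] as majorant. *)
Lemma L1_cutoff_cvg0 (A_ : nat -> set T) (mA : forall n, measurable (A_ n)) g :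
  {ae mu, forall t, D t -> \forall n \near \oo, ~ A_ n t} ->
  rnorm (L1_cutoff (mA n) g) @[n --> \oo] --> 0.
Proof.
move=> A0; pose F n t : \bar R := (rnorm (cutoff (A_ n) g t))%:E.
have mF n : measurable_fun D (F n).
  apply: (measurable_rnorm cmu mD).
  exact: strongly_measurable_cutoff (mA n) (bochnerP (repr g)).1.
have FE n : (rnorm (L1_cutoff (mA n) g))%:E = (\int[mu]_(t in D) F n t)%E.
  rewrite L1_rnormE; apply: ge0_ae_eq_integral => //.
  - exact: L1_measurable_rnorm.
  - by move=> t _; rewrite lee_fin rnorm_ge0.
  - by move=> t _; rewrite lee_fin rnorm_ge0.
  - by apply: filterS (L1_cutoffE (mA n) g) => t cg Dt; rewrite cg.
have [||||_ _ ] := @dominated_convergence _ _ _ mu D mD F (cst 0%E)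
   (fun t => (rnorm (g t))%:E) mF.
- exact: measurable_cst.
- apply: filterS A0 => t At Dt; apply: cvg_near_cst.
  apply: filterS (At Dt) => n nA; by rewrite /F cutoff_out// rnorm0.
- apply/integrableP; split; first exact: L1_measurable_rnorm.
  under eq_integral do rewrite gee0_abs ?lee_fin ?rnorm_ge0//.
  by rewrite -L1_rnormE ltry.
- apply: aeW => t n Dt; rewrite /F gee0_abs ?lee_fin ?rnorm_ge0//.
  by rewrite /cutoff /patch; case: ifP; rewrite // rnorm0 rnorm_ge0.
rewrite integral0; under eq_fun do rewrite -FE.
exact: fine_cvg.
Qed.

End L1_cutoff.

(** * Concentration of a functional near a point of the line *)

Section concentration.
Context {R : realType} {k : scalar_kind} {X : normedModType (scalars R k)}.
Local Notation T := (lebesgue_line R).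
Local Notation mu := (lebesgue_mu R).
Local Notation D := (unit_interval R).
Implicit Types (A B : set T) (g h : L1 X).

Lemma measurable_interval (i : interval R) : measurable ([set` i] : set T).
Proof. by apply: sub_caratheodory; exact: measurable_itv. Qed.

Definition supported_in A h := {ae mu, forall t, D t -> ~ A t -> h t = 0}.

Lemma supported_cutoff A (mA : measurable A) h :
  supported_in A h -> L1_cutoff mA h = h.
Proof.
move=> Ah; apply/L1_ext/(ae_eq_trans (L1_cutoffE mA h)).
apply: filterS Ah => t Ah Dt; have [At|At] := pselect (A t).
  by rewrite cutoff_in.
by rewrite cutoff_out// Ah.
Qed.

Variables (theta : dual (L1 X)) (delta : R).

Definition small_on A := forall h, supported_in A h ->
  rnorm (theta h) <= delta * rnorm h.

Lemma small_on_sub A B : A `<=` B -> small_on B -> small_on A.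
Proof.
move=> AB sB h Ah; apply: sB; apply: filterS Ah => t Ah Dt nBt.
by apply: Ah => // /AB.
Qed.

(** Split [h] into its cutoff to [A] and the rest, which lives on [B]. Since the norms of the pieces
    add up to that of [h], the constant [delta] does not grow. *)
Lemma small_onU A B : measurable A -> small_on A -> small_on B ->
  small_on (A `|` B).
Proof.
move=> mA sA sB h ABh; have [_ _ ->] := L1_cutoff_Lprojection (X := X) mA.
have -> : theta h = theta (L1_cutoff mA h) + theta (h - L1_cutoff mA h).
  have := dual_linear theta 1 (L1_cutoff mA h) (h - L1_cutoff mA h).
  by rewrite !scale1r addrCA subrr addr0.
rewrite (le_trans (rnormD _ _))// mulrDr lerD//.
  apply: sA; apply: filterS (L1_cutoffE mA h) => t ch Dt nAt.
  by rewrite ch// cutoff_out.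
apply: sB; apply: filterS3 ABh (L1_cutoffE mA h) (L1_funB h (L1_cutoff mA h)).
move=> t ABh ch Bh Dt nBt; rewrite Bh// ch//; have [At|At] := pselect (A t).
  by rewrite cutoff_in// subrr.
by rewrite cutoff_out// subr0 ABh// => -[].
Qed.

Lemma small_on_disjoint A : (forall t, D t -> ~ A t) -> small_on A.
Proof.
move=> DA h Ah; have -> : h = 0.
  apply: L1_ext; apply: filterS2 Ah (L1_reprP (0 : bochnerType X)) => t Ah h0 Dt.
  by rewrite (Ah Dt (DA t Dt)); exact: esym (h0 Dt).
rewrite rnorm0 mulr0; have -> : theta 0 = 0; last by rewrite rnorm0.
by have := dual_linear theta (-1) 0 0; rewrite scaler0 addr0 scaleN1r addNr.
Qed.

(** A supremum argument as for Heine-Borel: [s] is the supremum of the [t] for which [theta] is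
    small on the half-line below [t]. A small interval around [s] would push smallness past [s]. *)
Lemma concentration_point x : delta * rnorm x < rnorm (theta x) ->
  exists s : R, forall eps, 0 < eps ->
    ~ small_on [set` `]s - eps, s + eps[ ].
Proof.
move=> bigx; pose S := [set t : R | small_on [set` `]-oo, t[ ]].
have S0 : S 0.
  apply: small_on_disjoint => t; rewrite /unit_interval/= !in_itv/= => /andP[t0 _].
  by apply/negP; rewrite -leNgt.
(* A half-line reaching beyond 2 contains [0,1], so it supports [x], on which [theta] is too
   large. *)
have S2 : ubound S 2.
  move=> t St; rewrite leNgt; apply/negP => t2; move: bigx; apply/negP; rewrite -leNgt.
  apply: St; apply: aeW => u; rewrite /unit_interval/= !in_itv/= => /andP[_ u1].
  by case; apply: le_lt_trans t2; lra.
exists (sup S) => eps eps0 sball.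
have hS : has_sup S by split; [exists 0|exists 2].
have [t St tS] := sup_adherent eps0 hS.
(* The half-line below [t] overlaps the interval around [sup S], and together they cover the
   half-line below [sup S + eps]. *)
have : S (sup S + eps).
  apply: small_on_sub (small_onU (measurable_interval _) St sball) => u /=.
  rewrite !in_itv/= => us; have [ut|ut] := ltP u t; [by left|right].
  by rewrite us andbT (lt_le_trans tS).
by move/(ub_le_sup hS.2); lra.
Qed.

End concentration.

(** Only [s] lies in all the intervals, and a singleton is null; any other [t] is left out once the
    radius falls below its distance to [s]. *)
Lemma ae_notin_shrinking {R : realType} (s : R) :
  {ae lebesgue_mu R, forall t, unit_interval R t ->
    \forall n \near \oo,
      ~ [set` `]s - n.+1%:R^-1, s + n.+1%:R^-1[ ] t}.
Proof.
exists [set s]; split.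
- by rewrite -set_itv1; exact: measurable_interval.
- exact: (lebesgue_measure_set1 s).
move=> t /= nt; apply: contrapT => ts; apply: nt => _.
have d0 : 0 < `|t - s| by rewrite normr_gt0 subr_eq0; apply/eqP.
have := near_infty_natSinv_lt (PosNum d0); apply: filterS => n /= nd.
rewrite in_itv/= -ltr_distl; apply/negP; rewrite -leNgt.
exact: ltW.
Qed.

Theorem theorem2p5 (R : realType) (k : scalar_kind)
    (X : completeNormedModType (scalars R k))
    (sepX : separable (dual X))
    (f : L1 X) (f1 : `|f| = 1)
    (f_neq0 : lebesgue_mu R [set t | unit_interval R t /\ `|f t| = 0] = 0%E) :
  compact (state_space f) <-> smooth_point f.
Proof.
split=> [cS|[_ [phi ->]]]; last exact: compact_set1.
split => //; have [phi Sphi] := state_space_nonempty f1; exists phi.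
apply/seteqP; split=> [psi Spsi|_ -> //] /=; apply: contrapT => psiphi.
pose theta := psi - phi.
have [x thetax] : exists x, theta x <> 0.
  apply: contrapT => theta0; apply: psiphi; apply/val_inj/funext => x /=.
  apply/eqP; rewrite -subr_eq0; apply/eqP; apply: contrapT => h.
  by apply: theta0; exists x.
have theta_gt0 : 0 < rnorm (theta x) by rewrite rnorm_gt0; apply/eqP.
have x0 := rnorm_ge0 x; have x1 : 0 < rnorm x + 1 by lra.
(* Adding 1 to the norm of [x] makes [delta * rnorm x] strictly smaller than [rnorm (theta x)]. *)
pose delta := rnorm (theta x) / (rnorm x + 1).
have delta0 : 0 < delta by rewrite divr_gt0.
have [|s ns] := @concentration_point _ _ _ theta delta x.
  by rewrite /delta mulrAC ltr_pdivrMr// ltr_pM2l//; lra.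
pose i n : interval R := `]s - n.+1%:R^-1, s + n.+1%:R^-1[.
apply: (compact_states_unique (P_ := fun n => L1_cutoff (measurable_interval (i n)))
  f1 cS Spsi Sphi _ _ delta0).
- by move=> n; exact: L1_cutoff_Lprojection.
- by move=> g; apply: L1_cutoff_cvg0; exact: ae_notin_shrinking.
(* A witness [h] to the failure of smallness is supported in the interval, hence fixed by the
   cutoff, and so serves as the required vector. *)
- move=> n; have /ns : 0 < n.+1%:R^-1 :> R by rewrite invr_gt0.
  move=> /existsNP[h /not_implyP[hi]] /negP; rewrite -ltNge => big.
  by exists h; rewrite supported_cutoff.
Qed.
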